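(* Let $n\ge2$, $A_0\in\mathsf{SL}(n)$ and $A_1\in T_{A_0}\mathsf{SL}(n)\setminus\{0\}$ be such that at least one of the following conditions holds: (i) writing the polar decomposition $A_0=OP$ with $O\in\mathsf{SO}(n)$ and $P$ symmetric positive definite, the matrix $O^TA_1$ is symmetric; (ii) the matrix $A_0^TA_1$ is symmetric; (iii) the matrix $A_1A_0^T$ is symmetric. Then the geodesic $A(t)$ on $\mathsf{SL}(n)$ (with the HS metric) with initial data $A(0)=A_0$, $A'(0)=A_1$ satisfies $\mathrm{II}(A'(t),A'(t))>0$ for all $t$, and hence is unbounded as $t\to\pm\infty$ (both as $t\to+\infty$ and as $t\to-\infty$).
   Context: $\mathcal{M}(n)$ is the space of real $n\times n$ matrices with the Hilbert-Schmidt inner product $\langle A,B\rangle=\operatorname{tr}(AB^T)$ and norm $|A|=\sqrt{\langle A,A\rangle}$. The HS metric on $\mathsf{SL}(n)=\{A\in\mathcal{M}(n):\det A=1\}$ is the Riemannian metric induced on it as a submanifold of the Euclidean space $\mathcal{M}(n)$. Tangent vectors $X\in T_A\mathsf{SL}(n)$ are regarded as matrices with $\operatorname{tr}(A^{-1}X)=0$. A curve $A(t)$ in $\mathsf{SL}(n)$ is a geodesic iff \[A''=\frac{\operatorname{tr}(A'A^{-1}A'A^{-1})}{\operatorname{tr}(A^{-1}A^{-T})}A^{-T}.\] The second fundamental form of $\mathsf{SL}(n)\subset\mathcal{M}(n)$ with respect to the unit normal $N(A)=A^{-T}/|A^{-T}|$ is $\mathrm{II}(X,Y)=\operatorname{tr}(A^{-1}XA^{-1}Y)/|A^{-1}|$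 for $X,Y\in T_A\mathsf{SL}(n)$. *)

(* Defs.v *)
From mathcomp Require Import all_boot all_order all_algebra.
From mathcomp Require Import all_classical all_reals all_analysis.
Set Implicit Arguments.
Unset Strict Implicit.
Unset Printing Implicit Defensive.
Import Order.TTheory GRing.Theory Num.Theory.
Import numFieldNormedType.Exports.
Local Open Scope classical_set_scope.
Local Open Scope ring_scope.

(* The library's norm `|A| on matrices is the sup norm, hence the separate
   Hilbert-Schmidt norm below; both induce the topology used for derivatives. *)
Definition hs_inner (R : realType) (n : nat) (A B : 'M[R]_n) : R :=
  \tr (A *m B^T).

Definition hs_norm (R : realType) (n : nat) (A : 'M[R]_n) : R :=
  Num.sqrt (hs_inner A A).

Definition SL (R : realType) (n : nat) : set 'M[R]_n := [set A | \det A = 1].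

Definition SO (R : realType) (n : nat) : set 'M[R]_n :=
  [set O | O^T *m O = 1%:M /\ \det O = 1].

Definition tangent_SL (R : realType) (n : nat) (A : 'M[R]_n) : set 'M[R]_n :=
  [set X | \tr (invmx A *m X) = 0].

Definition sym_posdef (R : realType) (n : nat) (P : 'M[R]_n) : Prop :=
  P^T = P /\ forall v : 'cV[R]_n, v != 0 -> 0 < (v^T *m P *m v) 0 0.

(* Geodesics R -> SL(n) of the metric induced by hs_inner, through their
   equation: A'' is the multiple of the normal direction A^-T for which the
   constraint \det A = 1 is preserved to second order. *)
Definition geodesic_SL (R : realType) (n : nat) (A : R -> 'M[R]_n) : Prop :=
  [/\ forall t, SL (A t),
      forall t, derivable A t 1,
      forall t, derivable (derive1 A) t 1 &
      forall t, derive1 (derive1 A) t =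
        (\tr (derive1 A t *m invmx (A t) *m derive1 A t *m invmx (A t)) /
         \tr (invmx (A t) *m (invmx (A t))^T)) *: (invmx (A t))^T].

(* Second fundamental form of SL(n) in the Euclidean space of matrices with
   respect to the unit normal A^-T / |A^-T|, for X, Y tangent at A. *)
Definition second_ff (R : realType) (n : nat) (A X Y : 'M[R]_n) : R :=
  \tr (invmx A *m X *m invmx A *m Y) / hs_norm (invmx A).

Definition unbounded_at_pinfty (R : realType) (n : nat) (A : R -> 'M[R]_n) :
  Prop := forall T M : R, exists2 t, T < t & M < hs_norm (A t).

Definition unbounded_at_ninfty (R : realType) (n : nat) (A : R -> 'M[R]_n) :
  Prop := forall T M : R, exists2 t, t < T & M < hs_norm (A t).

(* Main.v *)
(** Put h = tr((A' A^-1)^2), so that A'' = (h / |A^-1|^2) A^-T and II(A',A') has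
    the sign of h.  Since |A|^2'' = 2|A'|^2 + 2n h / |A^-1|^2 and the speed |A'|
    is constant, h > 0 makes |A|^2 strongly convex, hence unbounded both ways.
    If X is symmetric and nonzero and Q = B B^T is invertible, then
    tr(Q X Q X) = |B^T X B|^2 > 0.  In cases (ii) and (iii), A^T A' or A' A^T
    stays symmetric, because the antisymmetric parts are conserved momenta, and
    X is this matrix.  In case (i) one may take O = 1; then K = A - A^T solves the
    linear equation K'' = (h / |A^-1|^2) A^-T K A^-1 with zero initial data, so A
    stays symmetric, and positive definite because it stays invertible; here
    X = A' and Q = A^-1. *)
Require Import Defs.
From mathcomp Require Import all_boot all_order all_algebra.
From mathcomp Require Import all_classical all_reals all_analysis.
From mathcomp Require Import ring lra.
Set Implicit Arguments.
Unset Strict Implicit.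
Unset Printing Implicit Defensive.
Import Order.TTheory GRing.Theory Num.Theory.
Import numFieldNormedType.Exports.
Local Open Scope classical_set_scope.
Local Open Scope ring_scope.

(** * Differential calculus of matrix-valued curves *)

Lemma is_derive_mxP (R : realType) (m p : nat) (M : R -> 'M[R]_(m, p))
    (t : R) (D : 'M[R]_(m, p)) :
  is_derive t 1 M D <-> forall i j, is_derive t 1 (fun s => M s i j) (D i j).
Proof.
split=> [[dM <-] i j|dM].
  have dMij := (derivable_mxP M t 1).1 dM i j.
  by split=> //; rewrite derive_mx// mxE.
have {}dMd : derivable M t 1.
  by apply/derivable_mxP => i j; case: (dM i j).
by split=> //; rewrite derive_mx//; apply/matrixP => i j; rewrite mxE; case: (dM i j).
Qed.

Lemma is_derive_bigsum (R : realType) (I : Type) (r : seq I) (F : I -> R -> R)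
    (t : R) (dF : I -> R) :
  (forall i, is_derive t 1 (F i) (dF i)) ->
  is_derive t 1 (fun s => \sum_(i <- r) F i s) (\sum_(i <- r) dF i).
Proof.
move=> dFt; elim: r => [|i r IH].
  rewrite big_nil; under eq_fun do rewrite big_nil; exact: is_derive_cst.
rewrite big_cons; under eq_fun do rewrite big_cons; exact: is_deriveD.
Qed.

Lemma is_derive_mulmx (R : realType) (m p q : nat) (M : R -> 'M[R]_(m, p))
    (N : R -> 'M[R]_(p, q)) (t : R) (dM : 'M[R]_(m, p)) (dN : 'M[R]_(p, q)) :
  is_derive t 1 M dM -> is_derive t 1 N dN ->
  is_derive t 1 (fun s => M s *m N s) (dM *m N t + M t *m dN).
Proof.
move=> /is_derive_mxP hM /is_derive_mxP hN; apply/is_derive_mxP => i j.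
under eq_fun do rewrite mxE.
rewrite !mxE -big_split; apply: is_derive_bigsum => k.
have := is_deriveM (hM i k) (hN k j); rewrite /GRing.scale/= => h.
apply: (is_derive_eq h). rewrite addrC. rewrite [N t k j * _]mulrC. reflexivity. 
Qed.

Lemma is_derive_trmx (R : realType) (m p : nat) (M : R -> 'M[R]_(m, p))
    (t : R) (dM : 'M[R]_(m, p)) :
  is_derive t 1 M dM -> is_derive t 1 (fun s => (M s)^T) dM^T.
Proof.
move=> /is_derive_mxP hM; apply/is_derive_mxP => i j; rewrite mxE.
by under eq_fun do rewrite mxE.
Qed.

Lemma is_derive_mxtrace (R : realType) (n : nat) (M : R -> 'M[R]_n)
    (t : R) (dM : 'M[R]_n) :
  is_derive t 1 M dM -> is_derive t 1 (fun s => \tr (M s)) (\tr dM).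
Proof. by move=> /is_derive_mxP hM; apply: is_derive_bigsum => i. Qed.

(** Induction on the size by Laplace expansion along the first row: each cofactor is, up to sign, a
    determinant of smaller size. *)
Lemma derivable_det (R : realType) (n : nat) (M : R -> 'M[R]_n) (t : R) :
  derivable M t 1 -> derivable (fun s => \det (M s)) t 1.
Proof.
elim: n M => [|n IH] M dM.
  under eq_fun do rewrite det_mx00; exact: derivable_cst.
under eq_fun do rewrite (expand_det_row _ ord0).
pose dF j := 'D_1 (fun s => M s ord0 j * cofactor (M s) ord0 j) t.
suff : is_derive t 1 (fun s => \sum_j M s ord0 j * cofactor (M s) ord0 j)
  (\sum_j dF j) by case.
apply: is_derive_bigsum => j; apply: derivableP.
apply: derivableM; first exact: ((derivable_mxP M t 1).1 dM).
apply: derivableM; first exact: derivable_cst.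
apply: IH; apply/derivable_mxP => k l; under eq_fun do rewrite !mxE.
exact: ((derivable_mxP M t 1).1 dM).
Qed.

(** By Cramer's formula every entry of the inverse is a cofactor divided by the determinant, hence
    is built from derivable determinants. *)
Lemma derivable_invmx (R : realType) (n : nat) (M : R -> 'M[R]_n) (t : R) :
  (forall s, M s \in unitmx) -> derivable M t 1 ->
  derivable (fun s => invmx (M s)) t 1.
Proof.
move=> uM dM; apply/derivable_mxP => i j.
under eq_fun do rewrite /invmx uM !mxE /cofactor.
apply: derivableM.
  apply: derivableV; last exact: derivable_det.
  by have := uM t; rewrite unitmxE unitfE.
apply: derivableM; first exact: derivable_cst.
case: n M uM dM i j => [|n] M uM dM i j; first by case: i.
apply: derivable_det; apply/derivable_mxP => k l; under eq_fun do rewrite !mxE.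
exact: ((derivable_mxP M t 1).1 dM).
Qed.

Lemma is_derive_invmx (R : realType) (n : nat) (M : R -> 'M[R]_n) (t : R)
    (dM : 'M[R]_n) :
  (forall s, M s \in unitmx) -> is_derive t 1 M dM ->
  is_derive t 1 (fun s => invmx (M s)) (- (invmx (M t) *m dM *m invmx (M t))).
Proof.
move=> uM hM; have dI : derivable (fun s => invmx (M s)) t 1.
  by apply: derivable_invmx => //; case: hM.
have hI := derivableP dI; have [_ h] := is_derive_mulmx hM hI.
apply: (is_derive_eq hI); move: h; set D := ('D_1 _ t) => h.
(* The derivative exists, so its value can be read off by differentiating the constant product $M
   M^{-1} = 1$. *)
have E : (fun s => M s *m invmx (M s)) = cst 1%:M.
  by apply/funext => s; rewrite mulmxV.
move: h; rewrite E derive_cst => /esym/(congr1 (mulmx (invmx (M t)))).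
rewrite mulmx0 mulmxDr mulKmx// mulmxA => /eqP.
by rewrite addrC addr_eq0 => /eqP.
Qed.

(** * The Hilbert-Schmidt inner product and its inequalities *)

Lemma hs_innerE (R : realType) (n : nat) (A B : 'M[R]_n) :
  hs_inner A B = \sum_i \sum_j A i j * B i j.
Proof.
apply: eq_bigr => i _; rewrite mxE; apply: eq_bigr => j _; by rewrite mxE.
Qed.

Lemma hs_innerC (R : realType) (n : nat) (A B : 'M[R]_n) :
  hs_inner A B = hs_inner B A.
Proof. by rewrite /hs_inner -mxtrace_tr trmx_mul trmxK. Qed.

Lemma hs_inner_ge0 (R : realType) (n : nat) (A : 'M[R]_n) : 0 <= hs_inner A A.
Proof.
by rewrite hs_innerE sumr_ge0// => i _; rewrite sumr_ge0// => j _;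
  rewrite -expr2 sqr_ge0.
Qed.

Lemma hs_inner_eq0 (R : realType) (n : nat) (A : 'M[R]_n) :
  (hs_inner A A == 0) = (A == 0).
Proof.
apply/eqP/eqP => [|->]; last by rewrite /hs_inner mul0mx mxtrace0.
have sq_ge0 i j : 0 <= A i j * A i j by rewrite -expr2 sqr_ge0.
rewrite hs_innerE => /psumr_eq0P A0; apply/matrixP => i j; rewrite mxE.
have /psumr_eq0P Ai0 := A0 (fun k _ => sumr_ge0 _ (fun l _ => sq_ge0 k l)) i isT.
by apply/eqP; have /eqP := Ai0 (fun l _ => sq_ge0 i l) j isT;
  rewrite mulf_eq0 orbb.
Qed.

Lemma hs_inner_gt0 (R : realType) (n : nat) (A : 'M[R]_n) :
  (0 < hs_inner A A) = (A != 0).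
Proof. by rewrite lt_def hs_inner_eq0 hs_inner_ge0 andbT. Qed.

Lemma hs_inner_trmx (R : realType) (n : nat) (A : 'M[R]_n) :
  hs_inner A^T A^T = hs_inner A A.
Proof. by rewrite /hs_inner trmxK mxtrace_mulC. Qed.

Lemma hs_inner_le_add (R : realType) (n : nat) (A B : 'M[R]_n) :
  `|2 * hs_inner A B| <= hs_inner A A + hs_inner B B.
Proof.
rewrite !hs_innerE -!big_split mulr_sumr /=.
apply: le_trans (ler_norm_sum _ _ _) _; apply: ler_sum => i _.
rewrite mulr_sumr -big_split/=.
apply: le_trans (ler_norm_sum _ _ _) _; apply: ler_sum => j _.
rewrite ler_norml; apply/andP; split.
  have := sqr_ge0 (A i j + B i j); nra.
have := sqr_ge0 (A i j - B i j); nra.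
Qed.

(** Lagrange's identity: twice the gap between the two sides is a double sum of squares. *)
Lemma sum_Cauchy_Schwarz (R : realType) (n : nat) (x y : 'I_n -> R) :
  (\sum_k x k * y k) ^+ 2 <= (\sum_k x k ^+ 2) * (\sum_k y k ^+ 2).
Proof.
rewrite -subr_ge0 -(pmulr_rge0 _ (ltr0n R 2)).
have -> : 2 * ((\sum_k x k ^+ 2) * (\sum_k y k ^+ 2) - (\sum_k x k * y k) ^+ 2)
    = \sum_k \sum_l (x k * y l - x l * y k) ^+ 2.
  rewrite expr2 mulrBr mulr_natl mulr2n {1}[X in X + _ - _]mulrC !mulr_suml.
  rewrite mulr_sumr -big_split -sumrB; apply: eq_bigr => k _.
  rewrite !mulr_sumr -big_split -sumrB; apply: eq_bigr => l _ /=.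
  by ring.
by apply: sumr_ge0 => k _; apply: sumr_ge0 => l _; exact: sqr_ge0.
Qed.

(** Submultiplicativity of the squared norm: Cauchy-Schwarz is applied to each entry of the product,
    a row of [A] against a column of [B]. *)
Lemma hs_inner_mulmx_le (R : realType) (n : nat) (A B : 'M[R]_n) :
  hs_inner (A *m B) (A *m B) <= hs_inner A A * hs_inner B B.
Proof.
rewrite -[hs_inner B B]hs_inner_trmx !hs_innerE mulr_suml.
apply: ler_sum => i _; rewrite mulr_sumr; apply: ler_sum => j _.
rewrite -expr2 mxE.
under [X in _ <= X * _]eq_bigr do rewrite -expr2.
under [X in _ <= _ * X]eq_bigr do rewrite mxE -expr2.
exact: sum_Cauchy_Schwarz.
Qed.

(** * Gram matrices and Cholesky factorization *)

Lemma tr_gram_sym_gt0 (R : realType) (n : nat) (B S : 'M[R]_n) :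
  B \in unitmx -> S^T = S -> S != 0 ->
  0 < \tr (B *m B^T *m S *m (B *m B^T) *m S).
Proof.
move=> uB symS S0.
have -> : \tr (B *m B^T *m S *m (B *m B^T) *m S) =
    hs_inner (B^T *m S *m B) (B^T *m S *m B).
  by rewrite /hs_inner -!mulmxA mxtrace_mulC !trmx_mul trmxK symS -!mulmxA.
rewrite hs_inner_gt0; apply: contra_neq S0 => BSB.
have uBT : B^T \in unitmx by rewrite unitmx_tr.
by rewrite -[S](mulKmx uBT) -[_ *m S](mulmxK uB) BSB mul0mx mulmx0.
Qed.

Lemma quadratic_form_col_mx (R : realType) (n : nat) (P : 'M[R]_(1 + n)) (x : R) (w : 'cV[R]_n) :
  P^T = P ->
  ((col_mx x%:M w)^T *m P *m col_mx x%:M w) 0 0 =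
  x ^+ 2 * P 0 0 + 2 * x * (ursubmx P *m w) 0 0 + (w^T *m drsubmx P *m w) 0 0.
Proof.
move=> symP.
have dlE : dlsubmx P = (ursubmx P)^T by rewrite trmx_ursub symP.
rewrite -{1}[P]submxK tr_col_mx mul_row_block mul_row_col dlE.
have wE : (w^T *m (ursubmx P)^T) = (ursubmx P *m w)^T by rewrite trmx_mul.
rewrite wE tr_scalar_mx mulmxDl mulmxDl !mul_scalar_mx !mul_mx_scalar.
rewrite -!scalemxAl !mxE !lshift0 /=.
by ring.
Qed.

(** Cholesky factorization, by induction on the size: the Schur complement [S] of the top left entry
    [a] is again positive definite, and its factor [L] is bordered to give [B]. *)
Lemma posdef_gram (R : realType) (n : nat) (P : 'M[R]_n) :
  sym_posdef P -> exists B : 'M[R]_n, P = B *m B^T.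
Proof.
elim: n P => [|n IH] P [symP posP].
  by exists 0; apply/matrixP => -[].
pose a : R := P 0 0; pose b := ursubmx (P : 'M[R]_(1 + n)).
have a0 : 0 < a.
  (* The first basis vector, tested in the form, gives the corner entry. *)
  have := posP (col_mx 1%:M 0 : 'cV[R]_(1 + n)).
  rewrite (quadratic_form_col_mx 1 0 symP) mulmx0 !mulmx0 !mxE expr1n mul1r mulr0 !addr0.
  apply; apply/eqP => /(congr1 (@usubmx _ 1 n 1)); rewrite col_mxKu linear0.
  by move=> /matrixP/(_ 0 0); rewrite !mxE => /eqP; rewrite oner_eq0.
pose S := drsubmx (P : 'M[R]_(1 + n)) - a^-1 *: (b^T *m b).
have [|L SE] := IH S.
  split; first by rewrite /S linearB linearZ/= trmx_mul trmxK trmx_drsub symP.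
  (* This [x] minimizes the form of [P] at the vector with head [x] and tail [w]; the minimum is
     exactly the form of [S] at [w]. *)
  move=> w w0; pose x := - (a^-1 * (b *m w) 0 0).
  have := posP (col_mx x%:M w : 'cV[R]_(1 + n)) _; rewrite (quadratic_form_col_mx x w symP) -/a -/b.
  have -> : (w^T *m S *m w) 0 0 =
      x ^+ 2 * a + 2 * x * (b *m w) 0 0 + (w^T *m drsubmx (P : 'M[R]_(1 + n)) *m w) 0 0.
    rewrite /S mulmxBr mulmxBl -scalemxAr -scalemxAl mulmxA -trmx_mul.
    rewrite -[_ *m b *m w]mulmxA /x mxE [(- _ : 'M[R]_1) 0 0]mxE.
    rewrite [(a^-1 *: _ : 'M[R]_1) 0 0]mxE [(_^T *m _ : 'M[R]_1) 0 0]mxE.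
    rewrite big_ord1 [(_^T : 'M[R]_1) 0 0]mxE.
    by field; rewrite gt_eqF.
  apply; apply: contra_neq w0 => /(congr1 (@dsubmx _ 1 n 1)); rewrite col_mxKd => ->.
  by rewrite linear0.
pose r := Num.sqrt a; have r0 : r != 0 by rewrite gt_eqF// sqrtr_gt0.
have rr : r * r = a by rewrite -expr2 sqr_sqrtr// ltW.
pose B : 'M[R]_(1 + n) := block_mx r%:M 0 (r^-1 *: b^T) L.
exists B; change ((P : 'M[R]_(1 + n)) = B *m B^T).
rewrite -[LHS](@submxK _ 1 n 1 n) /B tr_block_mx mulmx_block.
rewrite !trmx0 !mul0mx !mulmx0 !addr0 tr_scalar_mx linearZ/= trmxK -SE.
congr block_mx.
- by rewrite -scalar_mxM rr [LHS]mx11_scalar !mxE !lshift0.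
- by rewrite mul_scalar_mx scalerA mulfV// scale1r.
- rewrite mul_mx_scalar scalerA mulfV// scale1r.
  by rewrite trmx_ursub symP.
- by rewrite -scalemxAl -scalemxAr scalerA -invfM rr addrC subrK.
Qed.

Lemma gram_unitmx (R : realType) (n : nat) (P B : 'M[R]_n) :
  P \in unitmx -> P = B *m B^T -> B \in unitmx.
Proof. by move=> uP PE; move: uP; rewrite PE unitmx_mul => /andP[]. Qed.

(** * One-variable estimates: mean value theorem, Gronwall, strong convexity *)

Lemma is_derive_continuous (R : realType) (f : R -> R) (t df : R) :
  is_derive t 1 f df -> {for t, continuous f}.
Proof. by case=> dft _; exact/differentiable_continuous/derivable1_diffP. Qed.

Lemma is_derive_comp_opp (R : realType) (f : R -> R) (t df : R) :
  is_derive (- t) 1 f df -> is_derive t 1 (fun s => f (- s)) (- df).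
Proof.
move=> hf; have := is_derive1_comp hf (is_deriveNid t (1 : R)).
by rewrite mulrN1.
Qed.

Lemma is_derive_MVT (R : realType) (f df : R -> R) (a b : R) :
  (forall t : R, is_derive t 1 f (df t)) -> a <= b ->
  exists2 c, a <= c <= b & f b - f a = df c * (b - a).
Proof.
move=> dft ab; have [] := @MVT_segment R f df a b ab.
- by apply: continuous_subspaceT => x; exact: (is_derive_continuous (dft x)).
- by move=> c; rewrite in_itv/=; exists c.
Qed.

(** With $C$ the maximum of [c] on $[0,t]$, the product $E(s) e^{-Cs}$ has nonpositive derivative on
    $[0,t]$ and starts at 0, so it is at most 0 at $t$, while $E \ge 0$. *)
Lemma Gronwall_eq0_pos (R : realType) (E dE c : R -> R) :
  (forall t : R, is_derive t 1 E (dE t)) -> continuous c ->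
  (forall t, 0 <= E t) -> (forall t, dE t <= c t * E t) -> E 0 = 0 ->
  forall t, 0 <= t -> E t = 0.
Proof.
move=> hE cc E0 dEle E00 t t0.
have [m _ cm] := EVT_max t0 (continuous_subspaceT cc).
pose g s := expR (- (c m * s)).
have hg (s : R) : is_derive s 1 g (- c m * g s).
  have h1 : is_derive s 1 (fun s : R => - (c m * s)) (- c m).
    have := is_deriveN (is_deriveZ (c m) (is_derive_id s (1 : R))).
    by rewrite /GRing.scale/= mulr1.
  have := @is_derive1_comp R expR _ s _ _ (is_derive_expR (- (c m * s))) h1.
  by rewrite mulrC.
have hG (s : R) : is_derive s 1 (E * g) (g s * (dE s - c m * E s)).
  have h := is_deriveM (hE s) (hg s); apply: (is_derive_eq h).
  by rewrite /GRing.scale/=; ring.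
have [s /andP[s0 st]] := is_derive_MVT hG t0.
have G0 : (E * g) 0 = 0 by have -> : (E * g) 0 = E 0 * g 0 by []; rewrite E00 mul0r.
rewrite G0 !subr0 => Gt.
have : (E * g) t <= 0.
  rewrite Gt mulr_le0_ge0// mulr_ge0_le0 ?expR_ge0// subr_le0.
  apply: le_trans (dEle s) _; apply: ler_wpM2r => //; apply: cm.
  by rewrite in_itv/= s0 st.
have -> : (E * g) t = E t * g t by [].
rewrite pmulr_lle0 ?expR_gt0// => Et.
by apply/eqP; rewrite eq_le Et E0.
Qed.

(** Negative times follow by the reflection $s \mapsto -s$, which flips the sign of [dE]; this is
    why the bound is on its absolute value. *)
Lemma Gronwall_eq0 (R : realType) (E dE c : R -> R) :
  (forall t : R, is_derive t 1 E (dE t)) -> continuous c ->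
  (forall t, 0 <= E t) -> (forall t, `|dE t| <= c t * E t) -> E 0 = 0 ->
  forall t, E t = 0.
Proof.
move=> hE cc E0 dEle E00 t; have [t0|t0] := leP 0 t.
  apply: (Gronwall_eq0_pos hE cc) => // s.
  exact: le_trans (ler_norm _) (dEle s).
rewrite -[t]opprK; apply: (@Gronwall_eq0_pos R (E \o -%R) (fun s => - dE (- s)) (c \o -%R)).
- by move=> s; exact: is_derive_comp_opp.
- by move=> s; apply: continuous_comp; [exact: opp_continuous|exact: cc].
- by move=> s; exact: E0.
- by move=> s; apply: le_trans (ler_norm _) _; rewrite normrN; exact: dEle.
- by rewrite /= oppr0.
- by rewrite oppr_ge0 ltW.
Qed.

(** Two uses of the mean value theorem give the quadratic lower bound $r(t) \ge r(0) + t(r'(0) +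
    ct)$ for $t \ge 0$. *)
Lemma unbounded_of_strongly_convex (R : realType) (r dr ddr : R -> R) (c : R) :
  (forall t : R, is_derive t 1 r (dr t)) -> (forall t : R, is_derive t 1 dr (ddr t)) ->
  0 < c -> (forall t, 2 * c <= ddr t) ->
  forall T M, exists2 t, T < t & M < r t.
Proof.
move=> hr hdr c0 cddr T M.
have h1 t : 0 <= t -> dr 0 + 2 * c * t <= dr t.
  move=> t0; have [s _] := is_derive_MVT hdr t0; rewrite subr0 => h.
  have := ler_wpM2r t0 (cddr s); lra.
have hu (t : R) : is_derive t 1 (fun s : R => r s - s * (dr 0 + c * s))
    (dr t - (dr 0 + 2 * c * t)).
  have hl : is_derive t 1 (fun s : R => dr 0 + c * s) c.
    have := is_deriveD (is_derive_cst (dr 0) t (1 : R))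
      (is_deriveZ c (is_derive_id t (1 : R))).
    by rewrite /GRing.scale/= mulr1 add0r.
  have h := is_deriveB (hr t) (is_deriveM (is_derive_id t (1 : R)) hl).
  by apply: (is_derive_eq h); rewrite /GRing.scale/=; ring.
have h2 t : 0 <= t -> r 0 + t * (dr 0 + c * t) <= r t.
  move=> t0; have [s /andP[s0 _]] := is_derive_MVT hu t0.
  rewrite mul0r !subr0 => h.
  have := h1 s s0; rewrite -subr_ge0 => /mulr_ge0/(_ t0); lra.
(* For $t \ge d$ the factor $r'(0) + ct$ is at least $|M - r(0)| + 1$. The extra [1] in the chosen
   time ensures $t \ge 1$, so multiplying by $t$ keeps this bound. *)
pose d := (`|M - r 0| + `|dr 0| + 1) / c.
have d0 : 0 <= d by rewrite divr_ge0// ?ltW// !addr_ge0.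
have cd : c * d = `|M - r 0| + `|dr 0| + 1 by rewrite /d mulrC divfK// gt_eqF.
exists (1 + `|T| + d).
  have := ler_norm T; lra.
set t := 1 + `|T| + d.
have t1 : 1 <= t by rewrite /t -addrA lerDl addr_ge0.
have t0 : 0 <= t by lra.
apply: lt_le_trans (h2 t t0).
have ct : c * d <= c * t by rewrite ler_pM2l// lerDr addr_ge0.
have := ler_norm (M - r 0); have := ler_norm (- dr 0); rewrite normrN => h3 h4.
have h5 : `|M - r 0| + 1 <= dr 0 + c * t by lra.
have := normr_ge0 (M - r 0); nra.
Qed.

(** * Positive definiteness along a path of invertible symmetric matrices *)

Lemma sum_sqr_gt0 (R : realType) (n : nat) (v : 'cV[R]_n) :
  v != 0 -> 0 < \sum_i v i 0 ^+ 2.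
Proof.
move=> v0; rewrite lt_def sumr_ge0 => [|i _]; last exact: sqr_ge0.
rewrite andbT; apply: contra_neq v0 => /psumr_eq0P q0.
apply/matrixP => i j; rewrite ord1 mxE; apply/eqP; rewrite -sqrf_eq0.
by apply/eqP/q0 => // k _; exact: sqr_ge0.
Qed.

(** A null vector [v] of the form would minimize it, so its gradient, a multiple of [P *m v], would
    vanish, against invertibility. Concretely, a small step from [v] along [-P *m v] makes the form
    negative. *)
Lemma sym_unit_psd_posdef (R : realType) (n : nat) (P : 'M[R]_n) :
  P^T = P -> P \in unitmx -> (forall v : 'cV_n, 0 <= (v^T *m P *m v) 0 0) ->
  sym_posdef P.
Proof.
move=> symP uP psdP; split=> // v v0; rewrite lt_def psdP andbT.
apply/negP => /eqP vPv.
pose w := P *m v; pose d := (w^T *m w) 0 0; pose c := (w^T *m P *m w) 0 0.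
have d0 : 0 < d.
  rewrite /d mxE; under eq_bigr do rewrite mxE -expr2.
  apply: sum_sqr_gt0; apply: contra_neq v0 => w0.
  by rewrite -[v](mulKmx uP) -/w w0 mulmx0.
have c0 : 0 <= c by exact: psdP.
pose s := - (d / (c + 1)).
have := psdP (v + s *: w).
have -> : ((v + s *: w)^T *m P *m (v + s *: w)) 0 0 = 2 * s * d + s ^+ 2 * c.
  have wE : w^T = v^T *m P by rewrite trmx_mul symP.
  have -> : (v + s *: w)^T = v^T + s *: w^T by rewrite linearD linearZ.
  rewrite !mulmxDl !mulmxDr -!scalemxAl -!scalemxAr.
  rewrite -wE -[w^T *m P *m v]mulmxA -/w.
  have entD (X Y : 'M[R]_1) : (X + Y) 0 0 = X 0 0 + Y 0 0 by rewrite mxE.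
  have entZ x (X : 'M[R]_1) : (x *: X) 0 0 = x * X 0 0 by rewrite mxE.
  have wv : (w^T *m v) 0 0 = 0 by rewrite wE.
  by rewrite !(entD, entZ) wv -/d -/c; ring.
rewrite leNgt => /negP; apply.
have c10 : 0 < c + 1 by lra.
have -> : 2 * s * d + s ^+ 2 * c = - (d ^+ 2 * (c + 2) / (c + 1) ^+ 2).
  by rewrite /s; field; rewrite gt_eqF.
rewrite oppr_lt0 divr_gt0 ?exprn_gt0// mulr_gt0 ?exprn_gt0//; lra.
Qed.

Lemma form_gt0_near1 (R : realType) (n : nat) (N : 'M[R]_n) :
  (forall i j, `|N i j - (1%:M : 'M[R]_n) i j| <= n.+1%:R^-1) ->
  forall v : 'cV_n, v != 0 -> 0 < (v^T *m N *m v) 0 0.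
Proof.
move=> Ne v v0; pose e : R := n.+1%:R^-1; pose q := \sum_i v i 0 ^+ 2.
have e0 : 0 < e by rewrite invr_gt0.
have q0 : 0 < q. by exact: sum_sqr_gt0.
have NE : (v^T *m N *m v) 0 0 =
    q + \sum_j \sum_i (N i j - (1%:M : 'M[R]_n) i j) * (v i 0 * v j 0).
  have -> : q = \sum_j \sum_i (1%:M : 'M[R]_n) i j * (v i 0 * v j 0).
    apply: eq_bigr => j _; rewrite (bigD1 j)//= big1 => [|i ij].
      by rewrite mxE eqxx mul1r addr0 expr2.
    by rewrite mxE (negbTE ij) mul0r.
  rewrite mxE -big_split; apply: eq_bigr => j _ /=.
  rewrite mxE -big_split mulr_suml; apply: eq_bigr => i _ /=.
  by rewrite mxE; ring.
have : - (e * n%:R * q) <= \sum_j \sum_i (N i j - (1%:M : 'M[R]_n) i j) * (v i 0 * v j 0).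
  (* Each error term is at most $e |v_i v_j| \le e(v_i^2 + v_j^2)/2$. Summed over all pairs this is
     $enq$, less than $q$ because $e = 1/(n+1)$. *)
  have -> : - (e * n%:R * q) =
      \sum_j \sum_i - (e / 2 * (v i 0 ^+ 2 + v j 0 ^+ 2)).
    under eq_bigr do rewrite sumrN -mulr_sumr big_split /= sumr_const card_ord -/q.
    rewrite sumrN -mulr_sumr big_split /= sumr_const card_ord sumrMnl -/q.
    rewrite -(mulr_natr q n); move: (n%:R : R) (e) (q) => x y z.
    by field.
  apply: ler_sum => j _; apply: ler_sum => i _.
  have := Ne i j; rewrite -/e; set z := N i j - _ => ze.
  rewrite lerNl; apply: le_trans (ler_norm _) _; rewrite normrN normrM.
  rewrite -mulrA; apply: ler_pM => //.
  rewrite ler_norml; have := sqr_ge0 (v i 0 - v j 0); have := sqr_ge0 (v i 0 + v j 0).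
  by move=> h1 h2; apply/andP; split; nra.
rewrite NE => h; have : e * n%:R * q < q.
  by rewrite gtr_pMl// mulrC ltr_pdivrMr// mul1r ltr_nat.
lra.
Qed.

(** The set [T] of times at which [M] is positive definite is open, closed and contains 0, so it is
    all of the connected real line. *)
Lemma sym_posdef_propagates (R : realType) (n : nat) (M dM : R -> 'M[R]_n) :
  (forall t : R, is_derive t 1 M (dM t)) -> (forall t, (M t)^T = M t) ->
  (forall t, M t \in unitmx) -> sym_posdef (M 0) ->
  forall t, sym_posdef (M t).
Proof.
move=> hM symM uM pos0.
pose T := [set t | sym_posdef (M t)].
have hform (X dX : R -> 'M[R]_n) (t : R) (v : 'cV[R]_n) : is_derive t 1 X (dX t) ->
    {for t, continuous (fun s => (v^T *m X s *m v) 0 0)}.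
  move=> hX; have := is_derive_mulmx (is_derive_mulmx (is_derive_cst v^T t (1 : R)) hX)
    (is_derive_cst v t (1 : R)).
  by move=> /is_derive_mxP/(_ 0 0)/is_derive_continuous.
have openT : open T.
  rewrite openE => t Tt; have [B BE] := posdef_gram Tt.
  have uB := gram_unitmx (uM t) BE.
  (* Congruence by a Gram factor of [M t] moves the base point to the identity, where closeness of
     entries suffices. *)
  pose N s := invmx B *m M s *m (invmx B)^T.
  have hN := is_derive_mulmx (is_derive_mulmx (is_derive_cst (invmx B) t (1 : R)) (hM t))
    (is_derive_cst (invmx B)^T t (1 : R)).
  have N1 : N t = 1%:M.
    by rewrite /N BE mulmxA mulVmx// mul1mx -trmx_mul mulVmx// trmx1.
  have Nnear : \forall s \near t, forall i j,
      `|N s i j - (1%:M : 'M[R]_n) i j| <= n.+1%:R^-1.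
    have near_ij i j : \forall s \near t, `|N s i j - (1%:M : 'M[R]_n) i j| <= n.+1%:R^-1.
      have /is_derive_mxP/(_ i j)/is_derive_continuous := hN.
      move=> /cvgrPdist_le/(_ n.+1%:R^-1); rewrite invr_gt0 ltr0n => /(_ isT).
      by apply: filterS => s; rewrite distrC -N1.
    have near_i i := filter_forall (nbhs_filter t) (near_ij i).
    exact: (filter_forall (nbhs_filter t) near_i).
  apply: filterS Nnear => s Ns; split=> // v v0.
  have -> : M s = B *m N s *m B^T.
    rewrite /N !mulmxA mulmxV// mul1mx -mulmxA -trmx_mul mulmxV//.
    by rewrite trmx1 mulmx1.
  have := form_gt0_near1 Ns (v := B^T *m v).
  rewrite trmx_mul trmxK !mulmxA; apply; apply: contra_neq v0.
  have uBT : B^T \in unitmx by rewrite unitmx_tr.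
  by move=> Bv; rewrite -[v](mulKmx uBT) Bv mulmx0.
have openCT : open (~` T).
  rewrite openE => t nTt.
  (* A symmetric invertible matrix that is not positive definite has a strictly negative direction,
     and strict negativity persists nearby. *)
  have [v vneg] : exists v : 'cV_n, (v^T *m M t *m v) 0 0 < 0.
    apply: contrapT => /forallNP h; apply: nTt.
    by apply: sym_unit_psd_posdef => // v; rewrite leNgt; apply/negP.
  have := hform _ _ t v (hM t) => /(@cvgr_lt _ _ _ _ _).
  move=> /(_ 0 vneg); apply: filterS => s sneg [_ /(_ v)].
  have v0 : v != 0 by apply: contraTneq vneg => ->; rewrite mulmx0 mxE ltxx.
  by move=> /(_ v0); rewrite ltNge (ltW sneg).
have : T = setT.
  have /connected_intervalP c : is_interval (@setT R) by [].
  apply: c; first by exists 0.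
    by exists T; rewrite ?setTI.
  by exists T; rewrite ?setTI// -openC.
by move=> TT t; have : setT t by []; rewrite -TT.
Qed.

(** * Symmetry and vanishing of matrix curves from their derivatives *)

Lemma is_derive_hs_inner (R : realType) (n : nat) (M N : R -> 'M[R]_n) (t : R)
    (dM dN : 'M[R]_n) :
  is_derive t 1 M dM -> is_derive t 1 N dN ->
  is_derive t 1 (fun s => hs_inner (M s) (N s))
    (hs_inner dM (N t) + hs_inner (M t) dN).
Proof.
move=> hM hN.
have h := is_derive_mxtrace (is_derive_mulmx hM (is_derive_trmx hN)).
by apply: (is_derive_eq h); rewrite linearD.
Qed.

Lemma hs_innerZ (R : realType) (n : nat) (a : R) (M : 'M[R]_n) :
  hs_inner (a *: M) (a *: M) = a ^+ 2 * hs_inner M M.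
Proof.
by rewrite /hs_inner linearZ/= -scalemxAl -scalemxAr !linearZ/= mulrA.
Qed.

Lemma sym_preserved (R : realType) (n : nat) (W dW : R -> 'M[R]_n) :
  (forall t : R, is_derive t 1 W (dW t)) -> (forall t, (dW t)^T = dW t) ->
  (W 0)^T = W 0 -> forall t, (W t)^T = W t.
Proof.
move=> hW symdW symW0 t.
have hD (s : R) : is_derive s 1 (fun s => (W s)^T - W s) 0.
  have h := is_deriveB (is_derive_trmx (hW s)) (hW s).
  by apply: (is_derive_eq h); rewrite symdW subrr.
apply/eqP; rewrite -subr_eq0; apply/eqP/matrixP => i j.
have hDij (s : R) : is_derive s 1 (fun s => ((W s)^T - W s) i j) 0.
  by have /is_derive_mxP/(_ i j) := hD s; rewrite mxE.
by rewrite (is_derive_0_is_cst t 0 hDij) symW0 subrr mxE.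
Qed.

(** The energy $E = |K|^2 + |K'|^2$ satisfies $|E'| \le (2 + c)E$, since $E' = 2\langle K,K'\rangle
    + 2\langle K',K''\rangle$; Gronwall applies to it. *)
Lemma second_order_Gronwall (R : realType) (n : nat) (K K1 K2 : R -> 'M[R]_n)
    (c : R -> R) :
  (forall t : R, is_derive t 1 K (K1 t)) ->
  (forall t : R, is_derive t 1 K1 (K2 t)) -> continuous c ->
  (forall t, 0 <= c t) ->
  (forall t, hs_inner (K2 t) (K2 t) <= c t * hs_inner (K t) (K t)) ->
  K 0 = 0 -> K1 0 = 0 -> forall t, K t = 0.
Proof.
move=> hK hK1 cc c0 K2_le K0 K10 t.
pose E s := hs_inner (K s) (K s) + hs_inner (K1 s) (K1 s).
have hE (s : R) := is_deriveD (is_derive_hs_inner (hK s) (hK s))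
  (is_derive_hs_inner (hK1 s) (hK1 s)).
have E0 s : E s = 0.
  apply: (Gronwall_eq0 (c := fun s => 2 + c s) hE).
  - by move=> u; apply: cvgD; [exact: cvg_cst|exact: cc].
  - by move=> u; rewrite addr_ge0 ?hs_inner_ge0.
  - move=> u /=; rewrite [hs_inner (K1 u) (K u)]hs_innerC.
    rewrite [hs_inner (K2 u) (K1 u)]hs_innerC -!mulr2n.
    rewrite -(mulr_natl (hs_inner (K u) _)) -(mulr_natl (hs_inner (K1 u) _)).
    apply: le_trans (ler_normD _ _) _.
    have := hs_inner_le_add (K u) (K1 u); have := hs_inner_le_add (K1 u) (K2 u).
    have := K2_le u; have := hs_inner_ge0 (K u); have := hs_inner_ge0 (K1 u).
    have := mulr_ge0 (c0 u) (hs_inner_ge0 (K1 u)).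
    rewrite -[(_ + _) u]/(E u) /E mulrDl !mulrDr; lra.
  - by rewrite -[LHS]/(E 0) /E K0 K10 /hs_inner mul0mx mxtrace0 addr0.
apply/eqP; rewrite -hs_inner_eq0 eq_le hs_inner_ge0 andbT -(E0 t) lerDl.
exact: hs_inner_ge0.
Qed.

(** * Geodesics of SL(n): conserved quantities, symmetry and unboundedness *)

Definition geodesic_coeff (R : realType) (n : nat) (A : R -> 'M[R]_n) (t : R) : R :=
  \tr (derive1 A t *m invmx (A t) *m derive1 A t *m invmx (A t)) /
  \tr (invmx (A t) *m (invmx (A t))^T).

Section Geodesic.
Variables (R : realType) (n : nat) (A : R -> 'M[R]_n).
Hypothesis geoA : geodesic_SL A.

Local Notation A' := (derive1 A).
Local Notation Ai t := (invmx (A t)).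

Lemma geodesic_unitmx t : A t \in unitmx.
Proof. by case: geoA => /(_ t) detA _ _ _; rewrite unitmxE detA unitr1. Qed.

Lemma geodesic_is_derive (t : R) : is_derive t 1 A (A' t).
Proof. by case: geoA => _ /(_ t) dA _ _; apply: (DeriveDef dA); rewrite derive1E. Qed.

Lemma geodesic_is_derive2 (t : R) :
  is_derive t 1 A' (geodesic_coeff A t *: (Ai t)^T).
Proof.
by case: geoA => _ _ /(_ t) dA /(_ t) A2; apply: (DeriveDef dA); rewrite -derive1E A2.
Qed.

Lemma geodesic_is_deriveV (t : R) :
  is_derive t 1 (fun s => Ai s) (- (Ai t *m A' t *m Ai t)).
Proof. exact/(is_derive_invmx geodesic_unitmx)/geodesic_is_derive. Qed.

Lemma geodesic_invmx_neq0 t : (0 < n)%N -> Ai t != 0.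
Proof.
move=> n0; apply/eqP => A0; have := mulVmx (geodesic_unitmx t).
rewrite A0 mul0mx => /matrixP/(_ (Ordinal n0) (Ordinal n0))/eqP.
by rewrite !mxE eqxx eq_sym oner_eq0.
Qed.

Lemma geodesic_coeffM t : (0 < n)%N ->
  geodesic_coeff A t * hs_inner (Ai t) (Ai t) =
  \tr (A' t *m Ai t *m A' t *m Ai t).
Proof.
by move=> n0; rewrite /geodesic_coeff divfK// hs_inner_eq0 geodesic_invmx_neq0.
Qed.

(** The derivative of $\mathrm{tr}(A^{-1}A')$ is $-\mathrm{tr}((A^{-1}A')^2)$ plus the coefficient
    times $|A^{-1}|^2$, and these cancel by the choice of the coefficient. *)
Lemma geodesic_tangent t : (0 < n)%N -> tangent_SL (A 0) (A' 0) ->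
  tangent_SL (A t) (A' t).
Proof.
move=> n0; rewrite /tangent_SL /= => tan0; rewrite -[RHS]tan0.
apply: (is_derive_0_is_cst (f := fun s => \tr (Ai s *m A' s))) => s.
have h := is_derive_mxtrace
  (is_derive_mulmx (geodesic_is_deriveV s) (geodesic_is_derive2 s)).
apply: (is_derive_eq h).
rewrite mulNmx linearD linearN/= -scalemxAr linearZ/= geodesic_coeffM//.
by rewrite -!mulmxA [\tr (Ai s *m _)]mxtrace_mulC !mulmxA addNr.
Qed.

(** The acceleration is normal: $\langle A'',A'\rangle$ is a multiple of $\mathrm{tr}(A^{-1}A') =
    0$. *)
Lemma geodesic_speed t : (0 < n)%N -> tangent_SL (A 0) (A' 0) ->
  hs_inner (A' t) (A' t) = hs_inner (A' 0) (A' 0).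
Proof.
move=> n0 tan0.
apply: (is_derive_0_is_cst (f := fun s => hs_inner (A' s) (A' s))) => s.
have h := is_derive_hs_inner (geodesic_is_derive2 s) (geodesic_is_derive2 s).
apply: (is_derive_eq h); rewrite [X in _ + X]hs_innerC /hs_inner -scalemxAl linearZ/=.
rewrite -trmx_mul mxtrace_tr mxtrace_mulC.
by rewrite [\tr _](geodesic_tangent s n0 tan0) mulr0 addr0.
Qed.

Lemma geodesic_velocity_neq0 t : (0 < n)%N -> tangent_SL (A 0) (A' 0) ->
  A' 0 != 0 -> A' t != 0.
Proof.
by move=> n0 tan0; rewrite -!hs_inner_eq0 -(geodesic_speed t n0 tan0).
Qed.

(* [A^T A' - A'^T A] and [A' A^T - A A'^T] are the momenta of the isometric
   right and left actions of SO(n). *)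
Lemma geodesic_sym_right t :
  ((A 0)^T *m A' 0)^T = (A 0)^T *m A' 0 ->
  ((A t)^T *m A' t)^T = (A t)^T *m A' t.
Proof.
move=> sym0; move: t; apply: (sym_preserved (W := fun s => (A s)^T *m A' s)) => //.
  move=> s; exact: is_derive_mulmx (is_derive_trmx (geodesic_is_derive s))
    (geodesic_is_derive2 s).
(* Since $A^T A^{-T} = 1$, the derivative is $A'^T A'$ plus a multiple of the identity, hence
   symmetric. *)
move=> s /=; rewrite -scalemxAr -trmx_mul mulVmx ?geodesic_unitmx// trmx1.
by rewrite linearD linearZ/= trmx_mul trmxK trmx1.
Qed.

Lemma geodesic_sym_left t :
  (A' 0 *m (A 0)^T)^T = A' 0 *m (A 0)^T ->
  (A' t *m (A t)^T)^T = A' t *m (A t)^T.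
Proof.
move=> sym0; move: t; apply: (sym_preserved (W := fun s => A' s *m (A s)^T)) => //.
  move=> s; exact: is_derive_mulmx (geodesic_is_derive2 s)
    (is_derive_trmx (geodesic_is_derive s)).
move=> s /=; rewrite -scalemxAl -trmx_mul mulmxV ?geodesic_unitmx// trmx1.
by rewrite linearD linearZ/= trmx_mul trmxK trmx1.
Qed.

Lemma geodesic_sym t : (0 < n)%N ->
  (A 0)^T = A 0 -> (A' 0)^T = A' 0 -> (A t)^T = A t.
Proof.
move=> n0 symA symA'.
pose K s := A s - (A s)^T; pose K' s := A' s - (A' s)^T.
pose K2 s := geodesic_coeff A s *: ((Ai s)^T *m K s *m Ai s).
have hK (s : R) : is_derive s 1 K (K' s).
  exact: is_deriveB (geodesic_is_derive s) (is_derive_trmx (geodesic_is_derive s)).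
have hK' (s : R) : is_derive s 1 K' (K2 s).
  have h := is_deriveB (geodesic_is_derive2 s)
    (is_derive_trmx (geodesic_is_derive2 s)).
  apply: (is_derive_eq h); rewrite /K2 linearZ/= trmxK -scalerBr; congr (_ *: _).
  (* This is the identity $A^{-T}(A - A^T)A^{-1} = A^{-T} - A^{-1}$. *)
  rewrite /K mulmxBr mulmxBl -mulmxA mulmxV ?geodesic_unitmx// mulmx1.
  by rewrite -trmx_mul mulmxV ?geodesic_unitmx// trmx1 mul1mx.
pose h s := \tr (A' s *m Ai s *m A' s *m Ai s).
(* Submultiplicativity bounds $|A^{-T}KA^{-1}|^2$ by $|A^{-1}|^4|K|^2$; the coefficient times
   $|A^{-1}|^2$ is [h], so the Gronwall factor is $h^2$. *)
have K2_le s : hs_inner (K2 s) (K2 s) <= h s ^+ 2 * hs_inner (K s) (K s).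
  have -> : h s ^+ 2 * hs_inner (K s) (K s) = geodesic_coeff A s ^+ 2 *
      (hs_inner (Ai s) (Ai s) ^+ 2 * hs_inner (K s) (K s)).
    by rewrite /h -geodesic_coeffM//; ring.
  rewrite hs_innerZ ler_wpM2l ?sqr_ge0//.
  apply: le_trans (hs_inner_mulmx_le _ _) _.
  rewrite expr2 mulrAC ler_wpM2r ?hs_inner_ge0//.
  by apply: le_trans (hs_inner_mulmx_le _ _) _; rewrite hs_inner_trmx.
have ch : continuous h.
  move=> s; have hAA := is_derive_mulmx (geodesic_is_derive2 s) (geodesic_is_deriveV s).
  have := is_derive_mxtrace (is_derive_mulmx
    (is_derive_mulmx hAA (geodesic_is_derive2 s)) (geodesic_is_deriveV s)).
  by move=> /is_derive_continuous.
apply/eqP; rewrite eq_sym -subr_eq0 -/(K t); apply/eqP.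
apply: (second_order_Gronwall (c := fun s => h s ^+ 2) hK hK' _ _ K2_le).
- have -> : (fun s => h s ^+ 2) = (fun s => h s * h s).
    by apply/funext => s; rewrite expr2.
  by move=> u; apply: cvgM; exact: ch.
- by move=> u; exact: sqr_ge0.
- by rewrite /K symA subrr.
- by rewrite /K' symA' subrr.
Qed.

Lemma geodesic_unbounded : (0 < n)%N -> tangent_SL (A 0) (A' 0) -> A' 0 != 0 ->
  (forall t, 0 <= \tr (A' t *m Ai t *m A' t *m Ai t)) ->
  unbounded_at_pinfty A /\ unbounded_at_ninfty A.
Proof.
move=> n0 tan0 v0 hge0.
pose r s := hs_inner (A s) (A s).
pose r1 s := hs_inner (A' s) (A s) + hs_inner (A s) (A' s).
pose A2 s := geodesic_coeff A s *: (Ai s)^T.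
pose r2 s := hs_inner (A2 s) (A s) + hs_inner (A' s) (A' s) +
  (hs_inner (A' s) (A' s) + hs_inner (A s) (A2 s)).
have hr (s : R) : is_derive s 1 r (r1 s).
  exact: is_derive_hs_inner (geodesic_is_derive s) (geodesic_is_derive s).
have hr1 (s : R) : is_derive s 1 r1 (r2 s).
  exact: is_deriveD
    (is_derive_hs_inner (geodesic_is_derive2 s) (geodesic_is_derive s))
    (is_derive_hs_inner (geodesic_is_derive s) (geodesic_is_derive2 s)).
pose c := hs_inner (A' 0) (A' 0); have c0 : 0 < c by rewrite hs_inner_gt0.
have r2_ge s : 2 * c <= r2 s.
  (* Here $\langle A'',A\rangle$ is the coefficient times $\mathrm{tr}(1) = n$, so the constant
     speed alone bounds the second derivative of $|A|^2$ below. *)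
  have : 0 <= hs_inner (A2 s) (A s).
    rewrite /A2 /hs_inner -scalemxAl linearZ/= mulr_ge0//.
      by rewrite divr_ge0// hs_inner_ge0.
    rewrite -trmx_mul mxtrace_tr mulmxV ?geodesic_unitmx//.
    by rewrite mxtrace1 ler0n.
  rewrite /r2 [hs_inner (A s) (A2 s)]hs_innerC (geodesic_speed s n0 tan0) -/c; lra.
have norm_gt s M : M ^+ 2 < r s -> M < hs_norm (A s).
  move=> Mr; apply: le_lt_trans (ler_norm M) _.
  by rewrite -sqrtr_sqr ltr_sqrt//; apply: le_lt_trans Mr; exact: sqr_ge0.
split=> T M.
  have [s Ts Ms] := unbounded_of_strongly_convex hr hr1 c0 r2_ge T (M ^+ 2).
  by exists s => //; exact: norm_gt.
(* The limit at minus infinity comes from the same convexity estimate for the time-reversed function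
   [r (- s)]. *)
have hrN (s : R) := is_derive_comp_opp (hr (- s)).
have hr1N (s : R) : is_derive s 1 (fun s => - r1 (- s)) (r2 (- s)).
  have h := is_deriveN (is_derive_comp_opp (hr1 (- s))).
  by apply: (is_derive_eq h); rewrite opprK.
have [s Ts Ms] := unbounded_of_strongly_convex hrN hr1N c0
  (fun s => r2_ge (- s)) (- T) (M ^+ 2).
by exists (- s); [rewrite ltrNl|exact: norm_gt].
Qed.

End Geodesic.

(** * Left multiplication by a rotation as an isometry *)

Lemma invmx_mul_orthl (R : realType) (n : nat) (O M : 'M[R]_n) :
  O^T *m O = 1%:M -> M \in unitmx -> invmx (O *m M) = invmx M *m O^T.
Proof.
move=> OO uM; have [_ uO] := mulmx1_unit OO.
have uOM : O *m M \in unitmx by rewrite unitmx_mul uO.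
apply: (can_inj (mulKmx uOM)); rewrite mulmxV// -mulmxA mulKVmx//.
by rewrite (mulmx1C OO).
Qed.

Section Isometry.
Variables (R : realType) (n : nat) (A : R -> 'M[R]_n) (O : 'M[R]_n).
Hypotheses (geoA : geodesic_SL A) (OSO : SO O).

Let OO : O^T *m O = 1%:M. Proof. by case: OSO. Qed.

Lemma derive1_mull (t : R) :
  derive1 (fun s => O *m A s) t = O *m derive1 A t.
Proof.
have h := is_derive_mulmx (is_derive_cst O t (1 : R)) (geodesic_is_derive geoA t).
by rewrite derive1E derive_val mul0mx add0r.
Qed.

(** Since $(OA)^{-T} = OA^{-T}$, both sides of the equation are multiplied by [O]; the traces in the
    coefficient do not change, by cyclicity. *)
Lemma geodesic_mull : geodesic_SL (fun t => O *m A t).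
Proof.
have hA (t : R) := is_derive_mulmx (is_derive_cst O t (1 : R))
  (geodesic_is_derive geoA t).
have hA' (t : R) := is_derive_mulmx (is_derive_cst O t (1 : R))
  (geodesic_is_derive2 geoA t).
have d1 : derive1 (fun s => O *m A s) = fun s => O *m derive1 A s.
  by apply/funext => s; exact: derive1_mull.
split=> t.
- case: geoA => /(_ t) detA _ _ _; case: OSO => _ detO.
  by rewrite /SL /= det_mulmx detA detO mulr1.
- by case: (hA t).
- by rewrite d1; case: (hA' t).
- rewrite d1 derive1E; have [_ ->] := hA' t.
  rewrite mul0mx add0r /geodesic_coeff.
  rewrite (invmx_mul_orthl OO (geodesic_unitmx geoA t)).
  rewrite !trmx_mul trmxK -scalemxAr; congr (_ / _ *: _); last first.
    by rewrite !mulmxA -[invmx (A t) *m O^T *m O]mulmxA OO mulmx1.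
  rewrite !mulmxA -(mulmxA (O *m _ *m _) O^T) OO mulmx1.
  by rewrite [RHS]mxtrace_mulC !mulmxA OO mul1mx.
Qed.

(** The matrix $A'A^{-1}$ is only conjugated by [O]. This carries positivity from the rotated
    geodesic back to the original one. *)
Lemma geodesic_trace_mull t :
  \tr (O *m derive1 A t *m invmx (O *m A t) *m (O *m derive1 A t) *m invmx (O *m A t))
  = \tr (derive1 A t *m invmx (A t) *m derive1 A t *m invmx (A t)).
Proof.
rewrite (invmx_mul_orthl OO (geodesic_unitmx geoA t)).
rewrite !mulmxA -(mulmxA (O *m _ *m _) O^T) OO mulmx1.
by rewrite mxtrace_mulC !mulmxA OO mul1mx.
Qed.

End Isometry.

(** * Positivity of the trace in the three symmetric cases *)

Section Positivity.
Variables (R : realType) (n : nat) (A : R -> 'M[R]_n).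
Hypotheses (geoA : geodesic_SL A) (n0 : (0 < n)%N).
Hypotheses (tan0 : tangent_SL (A 0) (derive1 A 0)) (v0 : derive1 A 0 != 0).

Local Notation A' := (derive1 A).
Local Notation Ai t := (invmx (A t)).

Let uA t : A t \in unitmx := geodesic_unitmx geoA t.
Let uAT t : (A t)^T \in unitmx. Proof. by rewrite unitmx_tr. Qed.
Let vt t : A' t != 0 := geodesic_velocity_neq0 geoA t n0 tan0 v0.

Lemma geodesic_trace_gt0_right t : ((A 0)^T *m A' 0)^T = (A 0)^T *m A' 0 ->
  0 < \tr (A' t *m Ai t *m A' t *m Ai t).
Proof.
move=> /(geodesic_sym_right geoA t); set S := (A t)^T *m A' t => symS.
have S0 : S != 0.
  by apply: contra_neq (vt t) => S0; rewrite -[A' t](mulKmx (uAT t)) -/S S0 mulmx0.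
(* Substituting $A' = A^{-T}S$ and cycling gives $\mathrm{tr}(QSQS)$ with $Q = A^{-1}A^{-T}$. *)
have AE : A' t = (Ai t)^T *m S by rewrite trmx_inv mulKmx.
have uB : Ai t \in unitmx by rewrite unitmx_inv.
have := tr_gram_sym_gt0 uB symS S0; rewrite !mulmxA => trS.
by rewrite AE mxtrace_mulC !mulmxA.
Qed.

Lemma geodesic_trace_gt0_left t : (A' 0 *m (A 0)^T)^T = A' 0 *m (A 0)^T ->
  0 < \tr (A' t *m Ai t *m A' t *m Ai t).
Proof.
move=> /(geodesic_sym_left geoA t); set S := A' t *m (A t)^T => symS.
have S0 : S != 0.
  by apply: contra_neq (vt t) => S0; rewrite -[A' t](mulmxK (uAT t)) -/S S0 mul0mx.
(* Now $A' = SA^{-T}$, so $Q = A^{-T}A^{-1}$ and the Gram factor is $A^{-T}$. *)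
have AE : A' t = S *m (Ai t)^T by rewrite trmx_inv mulmxK.
have uB : (Ai t)^T \in unitmx by rewrite unitmx_tr unitmx_inv.
clearbody S; have := tr_gram_sym_gt0 uB symS S0; rewrite trmxK !mulmxA => trS.
by rewrite AE -!mulmxA mxtrace_mulC !mulmxA.
Qed.

Lemma geodesic_trace_gt0_posdef t : sym_posdef (A 0) -> (A' 0)^T = A' 0 ->
  0 < \tr (A' t *m Ai t *m A' t *m Ai t).
Proof.
move=> posA symA'0; have [symA0 _] := posA.
have symA s : (A s)^T = A s := geodesic_sym geoA s n0 symA0 symA'0.
have symA' : (A' t)^T = A' t.
  have h := is_derive_trmx (geodesic_is_derive geoA t).
  have AT : (fun s => (A s)^T) = A by apply/funext => s; exact: symA.
  by move: h; rewrite AT => -[_ <-]; rewrite derive1E.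
have [B AB] := posdef_gram
  (sym_posdef_propagates (geodesic_is_derive geoA) symA uA posA t).
have uB := gram_unitmx (uA t) AB; have uBT : B^T \in unitmx by rewrite unitmx_tr.
(* If $A = BB^T$ then $A^{-1} = B^{-T}B^{-1}$, so the inverse is also a Gram matrix and serves as
   $Q$, with $A'$ as the symmetric matrix. *)
have AiE : Ai t = (invmx B)^T *m (invmx B)^T^T.
  apply: (can_inj (mulKmx (uA t))); rewrite mulmxV// trmxK {1}AB trmx_inv.
  by rewrite mulmxA mulmxK// mulmxV.
have uC : (invmx B)^T \in unitmx by rewrite unitmx_tr unitmx_inv.
have := tr_gram_sym_gt0 uC symA' (vt t); rewrite -AiE => trA.
by rewrite mxtrace_mulC !mulmxA.
Qed.

End Positivity.

Theorem theorem2p28 (R : realType) (n : nat) (hn : (2 <= n)%N)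
    (A0 A1 : 'M[R]_n) (hA0 : SL A0) (hA1 : tangent_SL A0 A1) (hA1n0 : A1 != 0)
    (hsym :
      [\/ exists O P : 'M[R]_n,
            [/\ SO O, sym_posdef P, A0 = O *m P & (O^T *m A1)^T = O^T *m A1],
          (A0^T *m A1)^T = A0^T *m A1
        | (A1 *m A0^T)^T = A1 *m A0^T])
    (A : R -> 'M[R]_n) (hgeo : geodesic_SL A)
    (hpos : A 0 = A0) (hvel : derive1 A 0 = A1) :
  (forall t : R, 0 < second_ff (A t) (derive1 A t) (derive1 A t)) /\
  unbounded_at_pinfty A /\ unbounded_at_ninfty A.
Proof.
have n0 : (0 < n)%N by exact: ltn_trans hn.
subst A0 A1.
have trace_gt0 t :
    0 < \tr (derive1 A t *m invmx (A t) *m derive1 A t *m invmx (A t)).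
  case: hsym => [exOP|symA|symA].
  - case: exOP => O [P [SOO posP A0E symOA]]; have [OO detO] := SOO.
    (* The curve $O^TA$ is a geodesic that starts at the positive definite $P$ with symmetric
       velocity $O^TA_1$, and has the same trace. *)
    have SOT : SO O^T by split; rewrite ?trmxK ?det_tr//; exact: mulmx1C.
    have geoB := geodesic_mull hgeo SOT.
    rewrite -(geodesic_trace_mull hgeo SOT) -(derive1_mull O^T hgeo).
    have uO : O^T \in unitmx by have [] := mulmx1_unit OO.
    apply: (geodesic_trace_gt0_posdef geoB) => //.
    + rewrite /tangent_SL /= (derive1_mull _ hgeo).
      case: SOT => OTO _; rewrite invmx_mul_orthl ?geodesic_unitmx//.
      by rewrite trmxK mulmxA -(mulmxA _ O) (mulmx1C OO) mulmx1.
    + rewrite (derive1_mull _ hgeo); apply: contra_neq hA1n0 => OA.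
      by rewrite -[LHS](mulKmx uO) OA mulmx0.
    + by rewrite A0E mulmxA OO mul1mx.
    + by rewrite (derive1_mull _ hgeo).
  - exact: geodesic_trace_gt0_right.
  - exact: geodesic_trace_gt0_left.
split; last by apply: geodesic_unbounded => // t; exact: ltW.
move=> t; rewrite /second_ff divr_gt0//.
  by rewrite -!mulmxA mxtrace_mulC !mulmxA; exact: trace_gt0.
by rewrite sqrtr_gt0 hs_inner_gt0 geodesic_invmx_neq0.
Qed.
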